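(* Let $W$ be a finite-dimensional real Hilbert space, and let $G\leq\operatorname{O}(W)$ be a finite group. Then for every subspace $V\leq W$, $$c_2(V^\perp/G_V)=c_2(W/G_V)\leq c_2(W/G),$$ where $G_V$ denotes the pointwise stabilizer of $V$ in $G$.
   Context: The group $G_V=\{g\in G: gv=v\text{ for all }v\in V\}$ acts trivially on $V$ and preserves the orthogonal complement $V^\perp$ of $V$ in $W$; $V^\perp/G_V$ denotes the quotient by the restricted action. If a group $G$ acts by isometries on a metric space $X$ with closed orbits, the orbit space $X/G$ carries the quotient metric $d([x],[y])=\inf_{p\in[x],\,q\in[y]}d_X(p,q)$, where $[x]=G\cdot x$. For a map $f\colon X\to Y$ of metric spaces, let $\alpha,\beta\in[0,\infty]$ be the largest and smallest constants (respectively) with $\alpha\, d_X(x,x')\le d_Y(f(x),f(x'))\le\beta\, d_X(x,x')$ for all $x,x'\in X$; the distortion of $f$ is $\kappa(f):=\beta/\alpha$, with $\kappa(f)=\infty$ if $\alpha=0$ or $\beta=\infty$. The Euclidean distortion $c_2(X)\in[1,\infty]$ is the infimum of all $c$ for which there exist a Hilbert space $H$ and a map $f\colon X\to H$ with $\kappa(f)=c$ (a one-point space is a degenerate case, for which $c_2$ is taken to be $1$). *)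

(* Defs.v *)
From HB Require Import structures.
From mathcomp Require Import all_boot all_order all_algebra.
From mathcomp Require Import sesquilinear.
From mathcomp Require Import all_classical all_reals all_analysis.
From mathcomp Require Import ring.

Set Implicit Arguments.
Unset Strict Implicit.
Unset Printing Implicit Defensive.

Import Order.TTheory GRing.Theory Num.Theory.
Import numFieldNormedType.Exports.

Local Open Scope classical_set_scope.
Local Open Scope ring_scope.

(* A finite-dimensional real Hilbert space is a [W : vectType R] with a positive
   definite symmetric bilinear form; completeness is then automatic. *)

Section Euclidean.
Variables (R : realType) (W : vectType R) (dot : {dot W for idfun}).

Definition euclid_dist (x y : W) : R := Num.sqrt (dot (x - y) (x - y)).

Let dotC x y : dot x y = dot y x.
Proof. by rewrite (hermC dot x y) /= expr0 mul1r. Qed.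

Let dotZl a x y : dot (a *: x) y = a * dot x y.
Proof. by rewrite linearZl_LR. Qed.

Let dotZr a x y : dot x (a *: y) = a * dot x y.
Proof. by rewrite dotC dotZl dotC. Qed.

Let dot_ge0 x : 0 <= dot x x.
Proof.
have [->|x0] := eqVneq x 0; first by rewrite linear0l.
exact/ltW/neq0_dnorm_gt0.
Qed.

Let dot_eq0 x : dot x x = 0 -> x = 0.
Proof.
move=> h; apply/eqP; apply: contraT => /(@neq0_dnorm_gt0 _ _ _ dot).
by rewrite h ltxx.
Qed.

Let dotDl x y z : dot (x + y) z = dot x z + dot y z.
Proof. by rewrite linearDl. Qed.

Let dotDr x y z : dot z (x + y) = dot z x + dot z y.
Proof. by rewrite linearDr. Qed.

Let dotBl x y z : dot (x - y) z = dot x z - dot y z.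
Proof. by rewrite linearBl. Qed.

Let dotBr x y z : dot z (x - y) = dot z x - dot z y.
Proof. by rewrite linearBr. Qed.

Let cauchy_schwarz x y : dot x y <= Num.sqrt (dot x x) * Num.sqrt (dot y y).
Proof.
have [->|y0] := eqVneq y 0; first by rewrite linear0r linear0l sqrtr0 mulr0.
have ygt0 := @neq0_dnorm_gt0 _ _ _ dot _ y0.
have := dot_ge0 (dot y y *: x - dot x y *: y).
have -> : dot (dot y y *: x - dot x y *: y) (dot y y *: x - dot x y *: y)
    = dot y y * (dot y y * dot x x - dot x y ^+ 2).
  by rewrite dotBl !dotBr !dotZl !dotZr (dotC y x); ring.
rewrite pmulr_rge0 // subr_ge0 => h.
rewrite -sqrtrM ?dot_ge0 // [dot x x * _]mulrC.
apply: le_trans (ler_norm _) _.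
by rewrite -sqrtr_sqr ler_wsqrtr.
Qed.

Lemma euclid_distxx x : euclid_dist x x = 0.
Proof. by rewrite /euclid_dist subrr linear0l sqrtr0. Qed.

Lemma euclid_dist_ge0 x y : 0 <= euclid_dist x y.
Proof. exact: sqrtr_ge0. Qed.

Lemma euclid_distC x y : euclid_dist x y = euclid_dist y x.
Proof. by rewrite /euclid_dist -opprB hnormN. Qed.

Lemma euclid_dist_eq0 x y : euclid_dist x y = 0 -> x = y.
Proof.
move/eqP; rewrite sqrtr_eq0 => h; apply/eqP; rewrite -subr_eq0; apply/eqP.
by apply: dot_eq0; apply/eqP; rewrite eq_le h dot_ge0.
Qed.

Lemma euclid_dist_triangle y x z :
  euclid_dist x z <= euclid_dist x y + euclid_dist y z.
Proof.
rewrite /euclid_dist -[x - z](subrKA y); move: (x - y) (y - z) => u v.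
rewrite -[leRHS]ger0_norm ?addr_ge0 ?sqrtr_ge0 // -sqrtr_sqr ler_wsqrtr //.
have -> : dot (u + v) (u + v) = dot u u + dot u v *+ 2 + dot v v.
  by rewrite dotDl !dotDr (dotC v u); ring.
rewrite sqrrD !sqr_sqrtr ?dot_ge0 //.
rewrite lerD2r lerD2l lerMn2r /=.
exact: cauchy_schwarz.
Qed.

Record finOrthGroup := FinOrthGroup {
  fog_set :> set 'End(W);
  fog_finite : finite_set fog_set;
  fog_isometry : forall g, fog_set g -> forall x y, dot (g x) (g y) = dot x y;
  fog1 : fog_set \1%VF;
  fogM : forall g h, fog_set g -> fog_set h -> fog_set (g \o h)%VF;
  fogV : forall g, fog_set g -> fog_set g^-1%VF }.

Lemma euclid_dist_isometry (G : finOrthGroup) g x y :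
  fog_set G g -> euclid_dist (g x) (g y) = euclid_dist x y.
Proof. by move=> Gg; rewrite /euclid_dist -linearB (fog_isometry Gg). Qed.

Lemma fogVK (G : finOrthGroup) g : fog_set G g -> cancel g g^-1%VF.
Proof.
move=> Gg; apply: lker0_lfunK; apply/lker0P => x y gxy.
by apply: euclid_dist_eq0; rewrite -(euclid_dist_isometry _ _ Gg) gxy
  euclid_distxx.
Qed.

Section PointwiseStabilizer.
Variables (G : finOrthGroup) (V : {vspace W}).

Let S : set 'End(W) := [set g | fog_set G g /\ forall v, v \in V -> g v = v].

Let S_finite : finite_set S.
Proof. by apply: sub_finite_set (fog_finite G) => g []. Qed.

Let S_isometry g : S g -> forall x y, dot (g x) (g y) = dot x y.
Proof. by move=> [Gg _]; exact: fog_isometry Gg. Qed.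

Let S1 : S \1%VF.
Proof. by split=> [|v _]; [exact: fog1|rewrite id_lfunE]. Qed.

Let SM g h : S g -> S h -> S (g \o h)%VF.
Proof.
move=> [Gg gV] [Gh hV]; split; first exact: fogM.
by move=> v vV; rewrite comp_lfunE /= hV // gV.
Qed.

Let SV g : S g -> S g^-1%VF.
Proof.
move=> [Gg gV]; split; first exact: fogV.
by move=> v vV; rewrite -[in LHS](gV v vV) (fogVK Gg).
Qed.

Definition pstab : finOrthGroup := FinOrthGroup S_finite S_isometry S1 SM SV.

Lemma pstab_orthov g u :
  fog_set pstab g -> u \in orthov dot V -> g u \in orthov dot V.
Proof.
move=> [Gg gV] /mem_orthovP uV; apply/mem_orthovP => v vV.
by rewrite -(gV v vV); exact: etrans (fog_isometry Gg u v) (uV v vV).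
Qed.

End PointwiseStabilizer.

Definition orbit_of (G : set 'End(W)) (x : W) : set W := [set g x | g in G].

Lemma orbit_of_refl (G : finOrthGroup) x : orbit_of G x x.
Proof. by exists \1%VF; [exact: fog1|rewrite id_lfunE]. Qed.

Lemma orbit_of_trans (G : finOrthGroup) x y z :
  orbit_of G x y -> orbit_of G y z -> orbit_of G x z.
Proof.
move=> [g Gg <-] [h Gh <-]; exists (h \o g)%VF; first exact: fogM.
by rewrite comp_lfunE.
Qed.

Lemma orbit_of_sym (G : finOrthGroup) x y : orbit_of G x y -> orbit_of G y x.
Proof.
by move=> [g Gg <-]; exists g^-1%VF; [exact: fogV|rewrite (fogVK Gg)].
Qed.

Lemma orbit_of_eq (G : finOrthGroup) x y :
  orbit_of G x y -> orbit_of G x = orbit_of G y.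
Proof.
move=> xy; apply/seteqP; split=> z; apply: orbit_of_trans => //.
exact: orbit_of_sym.
Qed.

(* The points of U/G are the G-orbits of the points of the subspace U. This
   is meant for a G-stable U, so that the orbits are those of the restricted
   action; [pstab_orthov] gives this for the orthogonal complement of V. *)
Definition orbit_space (G : finOrthGroup) (U : {vspace W}) : Type :=
  {A : set W | exists2 x, x \in U & A = orbit_of G x}.

Definition orbit_dist (G : finOrthGroup) (U : {vspace W})
    (A B : orbit_space G U) : R :=
  inf [set euclid_dist p q | p in sval A & q in sval B].

HB.instance Definition _ G U := gen_eqMixin (orbit_space G U).
HB.instance Definition _ G U := gen_choiceMixin (orbit_space G U).

Section OrbitSpaceMetric.
Variables (G : finOrthGroup) (U : {vspace W}).
Implicit Types A B C : orbit_space G U.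

Let dset A B := [set euclid_dist p q | p in sval A & q in sval B].

Let orbit_dist_le A B p q :
  sval A p -> sval B q -> orbit_dist A B <= euclid_dist p q.
Proof.
move=> Ap Bq; apply: ge_inf; last by exists p => //; exists q.
by exists 0 => _ [? _ [? _ <-]]; exact: euclid_dist_ge0.
Qed.

Let finite_min (D : set R) : finite_set D -> D !=set0 ->
  exists2 m, D m & lbound D m.
Proof.
move=> /finite_seqP[s ->] [y]; case: s => [|x s] //= _.
elim: s x => [|z s IH] x.
  by exists x => [|t] /=; rewrite mem_seq1 // => /eqP->.
have [m /= ms mlb] := IH z; have [xm|/ltW mx] := leP x m.
  exists x => [|t] /=; first exact: mem_head.
  by rewrite in_cons => /orP[/eqP->//|/mlb]; exact: le_trans.
exists m => [|t] /=; first by rewrite in_cons ms orbT.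
by rewrite in_cons => /orP[/eqP->//|/mlb].
Qed.

Let orbit_dist_attained A B :
  exists p q, [/\ sval A p, sval B q & orbit_dist A B = euclid_dist p q].
Proof.
have orbit_finite C : finite_set (sval C).
  by case: C => _ /= [x _ ->]; apply: finite_image; exact: fog_finite.
have orbit_nonempty C : sval C !=set0.
  by case: C => _ /= [x _ ->]; exists x; exact: orbit_of_refl.
have dfin : finite_set (dset A B) by apply: finite_image2.
have [|m [p Ap [q Bq <-]] mlb] := finite_min dfin.
  have [[a Aa] [b Bb]] := (orbit_nonempty A, orbit_nonempty B).
  by exists (euclid_dist a b); exists a => //; exists b.
exists p, q; split => //; apply/eqP; rewrite eq_le orbit_dist_le //=.
by apply: lb_le_inf => //; exists (euclid_dist p q); exists p => //; exists q.
Qed.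

Let orbit_space_eq A p : sval A p -> sval A = orbit_of G p.
Proof. by case: A => _ /= [x _ ->]; exact: orbit_of_eq. Qed.

Let orbit_distxx A : orbit_dist A A = 0.
Proof.
have [p [_ [Ap _ _]]] := orbit_dist_attained A A.
apply/eqP; rewrite eq_le -{1}(euclid_distxx p) orbit_dist_le //=.
by have [? [? [_ _ ->]]] := orbit_dist_attained A A; exact: euclid_dist_ge0.
Qed.

Let orbit_dist_eq0 A B : orbit_dist A B = 0 -> A = B.
Proof.
have [p [q [Ap Bq ->]]] := orbit_dist_attained A B => /euclid_dist_eq0 pq.
by apply: eq_sig_hprop => [? ? ?|]; [exact: Prop_irrelevance|
  rewrite (orbit_space_eq Ap) (orbit_space_eq Bq) pq].
Qed.

Let orbit_distC A B : orbit_dist A B = orbit_dist B A.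
Proof.
congr inf; apply/seteqP.
by split=> _ [p Ap [q Bq <-]]; exists q => //; exists p => //;
  exact: euclid_distC.
Qed.

Let orbit_dist_triangle B A C :
  orbit_dist A C <= orbit_dist A B + orbit_dist B C.
Proof.
have [p [q [Ap Bq ->]]] := orbit_dist_attained A B.
have [q' [r [Bq' Cr ->]]] := orbit_dist_attained B C.
have [g Gg gq] : orbit_of G q q' by rewrite -(orbit_space_eq Bq).
rewrite -(euclid_dist_isometry p q Gg) gq.
apply: le_trans (euclid_dist_triangle q' _ _); apply: orbit_dist_le => //.
by rewrite (orbit_space_eq Ap); exists g.
Qed.

HB.instance Definition _ := isMetric.Build R (orbit_space G U)
  orbit_distxx orbit_dist_eq0 orbit_distC orbit_dist_triangle.

End OrbitSpaceMetric.
End Euclidean.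

Record hilbert (R : realType) := Hilbert {
  hilbert_sort :> completeNormedModType R;
  hilbert_dot : {dot hilbert_sort for idfun};
  hilbert_dotE : forall x, hilbert_dot x x = `|x| ^+ 2 }.

Section Distortion.
Variable R : realType.
Local Open Scope ereal_scope.

(* The supremum and infimum below are attained, because [+oo * 0 = 0] in
   [\bar R]: they are the largest and smallest admissible constants. *)
Section Maps.
Variables (X : metricType R) (H : normedModType R) (f : X -> H).

Definition lower_const : \bar R := ereal_sup [set a : \bar R | 0 <= a /\
  forall x y : X, a * (mdist x y)%:E <= `|f x - f y|%:E].

Definition upper_const : \bar R := ereal_inf [set b : \bar R | 0 <= b /\
  forall x y : X, `|f x - f y|%:E <= b * (mdist x y)%:E].

Definition distortion : \bar R :=
  if (lower_const == 0) || (upper_const == +oo) then +oo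
  else upper_const / lower_const.

End Maps.

(* On a one-point space every map has [lower_const = +oo] and
   [upper_const = 0], hence the separate case. *)
Definition c2 (X : metricType R) : \bar R :=
  if `[< forall x y : X, x = y >] then 1
  else ereal_inf
    [set c | exists (H : hilbert R) (f : X -> H), distortion f = c].

End Distortion.

(* Main.v *)
(* Orthogonal decomposition along V gives W/G_V = V x (V^perp/G_V) isometrically.
   Given f : V^perp/G_V -> H with constants a <= b, the map (p, q) |-> (a p, f q)
   into V (+) H has the same constants, hence the equality.

   For the inequality choose v in V moved by every element of G outside G_V: near
   [v], W/G is isometric to a ball of W/G_V around [0], and by rescaling an
   embedding of W/G yields embeddings g_M of all the balls B(0, M) of W/G_V in
   one Hilbert space H, with the same constants and g_M(0) = 0. They are glued
   with an arbitrarily small loss: with u = e ln|x|, send x to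
     (sin u g_M(x), cos u g_M'(x)) in H (+) H,
   where M > |x| only depends on the interval between consecutive zeros of sin
   containing u, and M' likewise for cos. As the maps only change where their
   coefficient vanishes and u varies slowly, for |y| <= |x| the images of x and y
   differ by (sin u (g_M(x) - g_M(y)), cos u (g_M'(x) - g_M'(y))) up to
   O(e |x - y|). *)

Require Import Defs.
From HB Require Import structures.
From mathcomp Require Import all_boot all_order all_algebra.
From mathcomp Require Import sesquilinear.
From mathcomp Require Import all_classical all_reals all_analysis.
From mathcomp Require Import ring lra.
Set Implicit Arguments.
Unset Strict Implicit.
Unset Printing Implicit Defensive.
Import Order.TTheory GRing.Theory Num.Theory.
Import numFieldNormedType.Exports.
Local Open Scope classical_set_scope.
Local Open Scope ring_scope.

(** * The l2 sum of two Hilbert spaces *)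

(** By Lagrange's identity the two squares differ by [(p * y - q * x) ^+ 2]. *)
Lemma cauchy_schwarz2 (R : rcfType) (p q x y : R) : p * x + q * y
  <= Num.sqrt (p ^+ 2 + q ^+ 2) * Num.sqrt (x ^+ 2 + y ^+ 2).
Proof.
rewrite -sqrtrM ?addr_ge0 ?sqr_ge0 //.
apply: le_trans (ler_norm _) _; rewrite -sqrtr_sqr ler_wsqrtr //.
by have := sqr_ge0 (p * y - q * x); nra.
Qed.

Section HilbertSum.
Variables (R : realType) (H1 H2 : hilbert R).

(* An alias, because [H1 * H2] itself carries the max norm. *)
Definition hsum := (H1 * H2)%type.
HB.instance Definition _ := GRing.Lmodule.on hsum.

Definition hsum_norm (x : hsum) : R := Num.sqrt (`|x.1| ^+ 2 + `|x.2| ^+ 2).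

Let normD x y : hsum_norm (x + y) <= hsum_norm x + hsum_norm y.
Proof.
rewrite -[leRHS]ger0_norm ?addr_ge0 ?sqrtr_ge0 // -sqrtr_sqr ler_wsqrtr //.
rewrite sqrrD !sqr_sqrtr ?addr_ge0 ?sqr_ge0 //.
have := cauchy_schwarz2 `|x.1| `|x.2| `|y.1| `|y.2|.
have := ler_normD x.1 y.1; have := ler_normD x.2 y.2.
have := normr_ge0 (x.1 + y.1); have := normr_ge0 (x.2 + y.2).
by rewrite /hsum_norm; nra.
Qed.

Let normZ (a : R) x : hsum_norm (a *: x) = `|a| * hsum_norm x.
Proof.
rewrite /hsum_norm /= !normrZ !exprMn -mulrDr sqrtrM ?sqr_ge0 //.
by rewrite sqrtr_sqr normr_id.
Qed.

Let norm_eq0 x : hsum_norm x = 0 -> x = 0.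
Proof.
move/eqP; rewrite sqrtr_eq0 => h; case: x h => x1 x2 /= h.
have := sqr_ge0 `|x1|; have := sqr_ge0 `|x2| => h2 h1.
have /eqP : `|x1| ^+ 2 = 0 by lra.
have /eqP : `|x2| ^+ 2 = 0 by lra.
by rewrite !sqrf_eq0 !normr_eq0 => /eqP-> /eqP->.
Qed.

HB.instance Definition _ :=
  @Lmodule_isNormed.Build R hsum hsum_norm normD normZ norm_eq0.

Lemma hsum_normE (x : hsum) : `|x| = Num.sqrt (`|x.1| ^+ 2 + `|x.2| ^+ 2).
Proof. by []. Qed.

Lemma hsum_norm1 (x : hsum) : `|x.1| <= `|x|.
Proof.
rewrite hsum_normE -[leLHS]ger0_norm // -sqrtr_sqr ler_wsqrtr //.
by rewrite lerDl sqr_ge0.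
Qed.

Lemma hsum_norm2 (x : hsum) : `|x.2| <= `|x|.
Proof.
rewrite hsum_normE -[leLHS]ger0_norm // -sqrtr_sqr ler_wsqrtr //.
by rewrite lerDr sqr_ge0.
Qed.

Lemma hsum_norm_le (x : hsum) : `|x| <= `|x.1| + `|x.2|.
Proof.
rewrite hsum_normE -[leRHS]ger0_norm ?addr_ge0 // -sqrtr_sqr ler_wsqrtr //.
by rewrite sqrrD lerD2r lerDl mulrn_wge0 // mulr_ge0.
Qed.

(** Both projections are 1-Lipschitz, so a Cauchy filter converges in each coordinate;
    [hsum_norm_le] recombines the two limits. *)
Let complete (F : set_system hsum) : ProperFilter F -> cauchy F -> cvg F.
Proof.
move=> FF /cauchyP Fc.
have c1 : cauchy ((fun x : hsum => x.1) @ F).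
  apply: cauchy_exP => e e0; have [x Fx] := Fc e e0; exists x.1.
  apply: (@filterS _ F _ _ _ _ Fx) => y; rewrite /= -!ball_normE /=.
  exact: le_lt_trans (hsum_norm1 (x - y)).
have c2 : cauchy ((fun x : hsum => x.2) @ F).
  apply: cauchy_exP => e e0; have [x Fx] := Fc e e0; exists x.2.
  apply: (@filterS _ F _ _ _ _ Fx) => y; rewrite /= -!ball_normE /=.
  exact: le_lt_trans (hsum_norm2 (x - y)).
have /cvg_ex[/= l1 /cvgrPdist_lt F1] : cvg ((fun x : hsum => x.1) @ F).
  exact: cauchy_cvg.
have /cvg_ex[/= l2 /cvgrPdist_lt F2] : cvg ((fun x : hsum => x.2) @ F).
  exact: cauchy_cvg.
apply/cvg_ex; exists ((l1, l2) : hsum).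
apply/cvgrPdist_lt => e e0; have e2 : 0 < e / 2 by rewrite divr_gt0.
apply: filterS2 (F1 _ e2) (F2 _ e2) => x x1 x2.
apply: le_lt_trans (hsum_norm_le _) _.
by rewrite [ltRHS]splitr ltrD.
Qed.

HB.instance Definition _ := Uniform_isComplete.Build hsum complete.

Definition hsum_dot (x y : hsum) : R :=
  hilbert_dot H1 x.1 y.1 + hilbert_dot H2 x.2 y.2.

Let bilin : bilinear_for *%R (@idfun R \; *%R) hsum_dot.
Proof.
split=> u a x y; rewrite /hsum_dot /=.
  by rewrite !linearDl !linearZl_LR /=; ring.
by rewrite !linearDr !linearZr_LR /=; ring.
Qed.

HB.instance Definition _ := bilinear_isBilinear.Build R hsum hsum R
  *%R (@idfun R \; *%R) hsum_dot bilin.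

Let herm x y : hsum_dot x y = (-1) ^+ false * idfun (hsum_dot y x).
Proof.
by rewrite /hsum_dot hermC [X in _ + X]hermC /= expr0 !mul1r.
Qed.

HB.instance Definition _ :=
  isHermitianSesquilinear.Build R hsum false idfun hsum_dot herm.

Let dotE x : hsum_dot x x = `|x| ^+ 2.
Proof.
by rewrite hsum_normE sqr_sqrtr ?addr_ge0 ?sqr_ge0 // /hsum_dot !hilbert_dotE.
Qed.

Let dot_gt0 x : x != 0 -> 0 < hsum_dot x x.
Proof. by move=> x0; rewrite dotE exprn_gt0 // normr_gt0. Qed.

HB.instance Definition _ := isDotProduct.Build R hsum hsum_dot dot_gt0.

Definition hilbert_sum : hilbert R := @Hilbert R hsum hsum_dot dotE.

End HilbertSum.

(** * The real line as a Hilbert space *)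

Section HilbertReal.
Variable R : realType.

Definition mul_dot (x y : R^o) : R := x * y.

Let bilin : bilinear_for *%R (@idfun R \; *%R) mul_dot.
Proof.
by split=> u a x y; rewrite /mul_dot /= /GRing.scale /=; ring.
Qed.

HB.instance Definition _ := bilinear_isBilinear.Build R R^o R^o R
  *%R (@idfun R \; *%R) mul_dot bilin.

Let herm x y : mul_dot x y = (-1) ^+ false * idfun (mul_dot y x).
Proof. by rewrite /mul_dot expr0 mul1r mulrC. Qed.

HB.instance Definition _ :=
  isHermitianSesquilinear.Build R R^o false idfun mul_dot herm.

Let dotE (x : R^o) : mul_dot x x = `|x| ^+ 2.
Proof. by rewrite real_normK ?num_real. Qed.

Let dot_gt0 (x : R^o) : x != 0 -> 0 < mul_dot x x.
Proof. by move=> x0; rewrite dotE exprn_gt0 // normr_gt0. Qed.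

HB.instance Definition _ := isDotProduct.Build R R^o mul_dot dot_gt0.

Definition hilbert_real : hilbert R := @Hilbert R R^o mul_dot dotE.

End HilbertReal.

(** * Distortion and bi-Lipschitz constants *)

Section C2.
Variable R : realType.
Implicit Types X Y : metricType R.

(** The constants are real, need not be optimal and carry no sign condition, so a perturbed lower
    constant [a - d] is always allowed. *)
Definition bilipschitz X (H : normedModType R) (a b : R) (f : X -> H) :=
  forall x y, a * mdist x y <= `|f x - f y| <= b * mdist x y.

Lemma bilipschitz_le X (H : normedModType R) a b (f : X -> H) (x y : X) :
  x <> y -> bilipschitz a b f -> a <= b.
Proof.
move=> /eqP xy /(_ x y) /andP[h1 h2].
by have := le_trans h1 h2; rewrite ler_pM2r // mdist_gt0.
Qed.

Lemma distortion_le X (H : normedModType R) a b (f : X -> H) (x y : X) :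
  x <> y -> 0 < a -> bilipschitz a b f -> (distortion f <= (b / a)%:E)%E.
Proof.
move=> xy a0 fab.
have ab := bilipschitz_le xy fab; have b0 := lt_le_trans a0 ab.
have la : (a%:E <= lower_const f)%E.
  apply: ereal_sup_ubound; split=> [|u v]; first by rewrite lee_fin ltW.
  by rewrite -EFinM lee_fin; case/andP: (fab u v).
have ub : (upper_const f <= b%:E)%E.
  apply: ereal_inf_lbound; split=> [|u v]; first by rewrite lee_fin ltW.
  by rewrite -EFinM lee_fin; case/andP: (fab u v).
have u0 : (0 <= upper_const f)%E by apply: le_ereal_inf_tmp => z [].
rewrite /distortion; case: ifP => [/orP[] /eqP h|_].
- by move: la; rewrite h lee_fin leNgt a0.
- by move: ub; rewrite h.
move: la ub u0.
case: (lower_const f) => [l||] //; case: (upper_const f) => [u||] //.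
  rewrite !lee_fin => al ub u0; have l0 := lt_le_trans a0 al.
  rewrite inver gt_eqF // -EFinM lee_fin ler_pM ?invr_ge0 ?(ltW l0) //.
  by rewrite lef_pV2.
(* Here [lower_const f = +oo], whose inverse is 0, so the quotient is 0. *)
by move=> _ _ u0; rewrite invey mule0 lee_fin divr_ge0 // ltW.
Qed.

Lemma distortion_bilipschitz X (H : normedModType R) (f : X -> H) (x y : X) c :
  x <> y -> (distortion f < c%:E)%E ->
  exists a b, [/\ 0 < a, bilipschitz a b f & b < c * a].
Proof.
move=> /eqP xy; have d0 : 0 < mdist x y by rewrite mdist_gt0.
rewrite /distortion; case: ifPn => //; rewrite negb_or => /andP[].
have l0 : (0 <= lower_const f)%E.
  by apply: ereal_sup_ubound; split=> // u v; rewrite mul0e lee_fin.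
have u0 : (0 <= upper_const f)%E by apply: le_ereal_inf_tmp => z [].
have lP u v : u != v -> (lower_const f <= (`|f u - f v| / mdist u v)%:E)%E.
  rewrite -mdist_gt0 => uv; apply: ge_ereal_sup => a [a0 /(_ u v)].
  case: a a0 => [a||] //; last by rewrite gt0_mulye ?lte_fin.
  by rewrite -EFinM !lee_fin ler_pdivlMr.
have uP u v : u != v -> ((`|f u - f v| / mdist u v)%:E <= upper_const f)%E.
  rewrite -mdist_gt0 => uv; apply: le_ereal_inf_tmp => a [a0 /(_ u v)].
  case: a a0 => [a||] // _; last by rewrite leey.
  by rewrite -EFinM !lee_fin ler_pdivrMr.
(* The instance at the distinct points [x] and [y] rules out [lower_const f = +oo]. *)
move: l0 u0 lP uP (lP _ _ xy).
case: (lower_const f) => [l||] //; case: (upper_const f) => [u||] //.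
rewrite !lee_fin => l0 u0 lP uP _ ln0 _.
have {ln0} l0 : 0 < l by rewrite lt_neqAle eq_sym l0 andbT; apply: ln0.
rewrite inver gt_eqF // -EFinM lte_fin ltr_pdivrMr // => ulc.
exists l, u; split=> // s t.
have [->|st] := eqVneq s t; first by rewrite mdistxx !mulr0 subrr normr0 lexx.
move: (lP _ _ st) (uP _ _ st); have := st; rewrite -mdist_gt0 => d.
by rewrite !lee_fin ler_pdivlMr // ler_pdivrMr // => -> ->.
Qed.

Lemma c2_le X (H : hilbert R) a b (f : X -> H) (x y : X) :
  x <> y -> 0 < a -> bilipschitz a b f -> (c2 X <= (b / a)%:E)%E.
Proof.
move=> xy a0 fab; rewrite /c2 asboolF => [|/(_ x y)//].
apply: le_trans (distortion_le xy a0 fab).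
by apply: ereal_inf_lbound; exists H, f.
Qed.

Lemma c2_lt X c (x y : X) : x <> y -> (c2 X < c%:E)%E ->
  exists (H : hilbert R) (f : X -> H) a b,
    [/\ 0 < a, bilipschitz a b f & b < c * a].
Proof.
move=> xy; rewrite /c2 asboolF => [|/(_ x y)//].
move=> /ereal_inf_lt[_ [H [f <-]] fc]; exists H, f.
exact: distortion_bilipschitz xy fc.
Qed.

Lemma c2_ge1 X : (1 <= c2 X)%E.
Proof.
have [h|] := pselect (forall x y : X, x = y); first by rewrite /c2 asboolT.
move=> /existsNP[x /existsNP[y xy]].
rewrite leNgt; apply/negP => /(c2_lt xy)[H [f [a [b [a0 fab]]]]].
by rewrite mul1r ltNge (bilipschitz_le xy fab).
Qed.

(** Reduces a comparison of Euclidean distortions to transferring embeddings with arbitrarily small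
    loss: if some [c] lay strictly between [c2 Y] and [c2 X], an embedding of [Y] with [b < c * a]
    would leave room for a perturbation of ratio exactly [c]. *)
Lemma c2_le_perturb X Y (x x' : X) (y y' : Y) : x <> x' -> y <> y' ->
  (forall (H : hilbert R) (f : Y -> H) a b d, 0 < a -> a <= b -> 0 < d ->
    bilipschitz a b f -> exists (H' : hilbert R) (f' : X -> H'),
      bilipschitz (a - d) (b + d) f') ->
  (c2 X <= c2 Y)%E.
Proof.
move=> xx' yy' XY; rewrite leNgt; apply/negP => cYX.
have c1 := c2_ge1 Y.
have [c] : exists c : R, (c2 Y < c%:E < c2 X)%E.
  move: cYX c1; case: (c2 Y) => [v||] //; case: (c2 X) => [u||] //.
    by rewrite lte_fin => vu _; exists ((v + u) / 2); rewrite !lte_fin !midf_lt.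
  by move=> _ _; exists (v + 1); rewrite lte_fin ltrDl ltr01 ltry.
move=> /andP[/[dup] Yc /(c2_lt yy') [H [f [a [b [a0 fab bca]]]]]].
have ab := bilipschitz_le yy' fab; have b0 := lt_le_trans a0 ab.
have c0 : 0 < c by rewrite -(pmulr_lgt0 _ a0) (lt_trans b0 bca).
(* The solution of [b + d = c * (a - d)]. *)
pose d := (c * a - b) / (1 + c).
have d0 : 0 < d by rewrite divr_gt0 ?subr_gt0 // addr_gt0.
have dE : b + d = c * (a - d).
  by rewrite /d; field; rewrite gt_eqF // addr_gt0.
have [H' [f' f'P]] := XY H f a b d a0 ab d0 fab.
have ad0 : 0 < a - d by rewrite -(pmulr_rgt0 _ c0) -dE addr_gt0.
have := c2_le xx' ad0 f'P.
by rewrite dE mulfK ?gt_eqF // => /le_lt_trans h /h; rewrite ltxx.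
Qed.

End C2.

(** * Gluing embeddings of balls *)

Section Sine.
Variable R : realType.
Implicit Types x y : R.

Lemma sin_lipschitz x y : `|sin x - sin y| <= `|x - y|.
Proof.
wlog yx : x y / y <= x => [th|].
  by have [|/ltW] := leP y x => /th //; rewrite distrC [leRHS]distrC.
have [|c _ ->] := @MVT_segment R sin cos y x yx.
  by apply: continuous_subspaceT; exact: continuous_sin.
by rewrite normrM ler_piMl // cos_max.
Qed.

Lemma sin_intpi (k : int) : sin (k%:~R * pi) = 0 :> R.
Proof.
have sinn n : sin (n%:R * pi) = 0 :> R.
  elim: n => [|n IH]; first by rewrite mul0r sin0.
  by rewrite -[n.+1]addn1 natrD mulrDl mul1r sinDpi IH oppr0.
case: k => n; first exact: sinn.
by rewrite NegzE mulrNz mulNr sinN sinn oppr0.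
Qed.

(** A multiple of [pi], hence a zero of the sine, lies between [x] and [y]; the Lipschitz bound is
    applied on either side of it. *)
Lemma sin_floor_neq x y : Num.floor (x / pi) != Num.floor (y / pi) ->
  `|sin x| + `|sin y| <= `|x - y|.
Proof.
wlog yx : x y / y <= x => [th h|].
  have [|/ltW] := leP y x => /th; first exact.
  by rewrite addrC distrC; apply; rewrite eq_sym.
set k := Num.floor (x / pi) => kn.
have pi0 := pi_gt0 R.
have kx : k%:~R * pi <= x by rewrite -ler_pdivlMr // floor_le_tmp.
have yk : y <= k%:~R * pi.
  rewrite -ler_pdivrMr // ltW // -floor_lt_int lt_neqAle eq_sym kn /=.
  by apply: le_floor; rewrite ler_pM2r ?invr_gt0.
have := sin_lipschitz x (k%:~R * pi); have := sin_lipschitz y (k%:~R * pi).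
rewrite sin_intpi !subr0 (distrC y) ![`|_ - _|]ger0_norm ?subr_ge0 //.
by lra.
Qed.

(** This is [ln s <= s - 1] at [s = x / y]. The factor [y] is what makes a logarithmic angle vary
    slowly relative to the size of the vectors it multiplies. *)
Lemma ln_sub_mul x y : 0 <= y -> y <= x -> `|ln x - ln y| * y <= x - y.
Proof.
rewrite le_eqVlt => /predU1P[<-|y0 yx]; first by rewrite mulr0 subr0.
have x0 := lt_le_trans y0 yx.
rewrite ger0_norm ?subr_ge0 ?ler_ln ?posrE // -ln_div ?posrE //.
have := @le_ln1Dx R (x / y - 1); rewrite subrKC => h.
apply: le_trans (ler_wpM2r (ltW y0) (h _)) _.
  by have := divr_gt0 x0 y0; lra.
by rewrite mulrBl mul1r divfK // gt_eqF.
Qed.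

End Sine.

Section Gluing.
Variables (R : realType) (X : metricType R) (o : X) (H : hilbert R) (a b : R).
Hypotheses (a0 : 0 < a) (ab : a <= b).
Variable g : R -> X -> H.
Hypothesis go : forall M, g M o = 0.
Hypothesis gP : forall M x y, mdist o x <= M -> mdist o y <= M ->
  a * mdist x y <= `|g M x - g M y| <= b * mdist x y.

Let b0 : 0 < b. Proof. exact: lt_le_trans ab. Qed.

Section Patch.
Variables (e phi : R).
Hypothesis e0 : 0 < e.

Let angle x : R := e * ln (mdist o x) + phi.
(** The distance from [o] at which [angle] reaches [(k + 1) * pi], the upper end of level [k]. *)
Let radius (k : int) : R := expR (((k%:~R + 1) * pi - phi) / e).
Let level x : int := Num.floor (angle x / pi).

(* [level] only jumps where the sine vanishes. *)
Definition patch x : H := sin (angle x) *: g (radius (level x)) x.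

Definition patch_map x : X -> H := g (radius (level x)).

Let radius_ge x : mdist o x <= radius (level x).
Proof.
(* At distance 0 the logarithm carries no information, but every radius is nonnegative. *)
have := mdist_ge0 o x; rewrite le_eqVlt => /predU1P[<-|o0].
  exact: expR_ge0.
rewrite -[leLHS]lnK ?posrE // ler_expR ler_pdivlMr // mulrC.
rewrite lerBrDr -ler_pdivrMr ?pi_gt0 // ltW //.
by have /andP[_] := floor_itv (angle x / pi); rewrite intrD.
Qed.

Lemma patch_mapP x y : mdist o y <= mdist o x ->
  a * mdist x y <= `|patch_map x x - patch_map x y| <= b * mdist x y.
Proof. by move=> yx; apply: gP => //; apply: le_trans yx _. Qed.

(** Up to a small error, [y] may be mapped with the coefficient and the embedding chosen for the
    farther point [x]. The error is a variation of the sine times a vector of norm at most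
    [b * mdist o y], and [ln_sub_mul] absorbs that factor. *)
Lemma patch_near x y : mdist o y <= mdist o x ->
  `|patch x - patch y - sin (angle x) *: (patch_map x x - patch_map x y)|
    <= e * b * mdist x y.
Proof.
move=> yx.
have g_le M : mdist o y <= M -> `|g M y| <= b * mdist o y.
  move=> yM; have oM : mdist o o <= M.
    by rewrite mdistxx (le_trans (mdist_ge0 o y)).
  by have /andP[_] := gP yM oM; rewrite go subr0 metric_sym.
have angleB : `|angle x - angle y| * (b * mdist o y) <= e * b * mdist x y.
  rewrite /angle opprD addrACA subrr addr0 -mulrBr normrM (gtr0_norm e0).
  rewrite mulrACA.
  rewrite ler_pM2l ?mulr_gt0 //.
  apply: le_trans (ln_sub_mul (mdist_ge0 _ _) yx) _.
  by rewrite lerBlDr addrC (metric_sym x) metric_triangle.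
(* There remains the difference of two multiples of images of [y]. At equal levels the images agree
   and only the sines differ; at different levels the two terms are bounded separately by
   [sin_floor_neq]. *)
rewrite /patch /patch_map scalerBr opprB addrC addrA subrK.
apply: le_trans angleB.
have [lxy|] := eqVneq (level x) (level y).
  rewrite lxy -scalerBl normrZ ler_pM ?normr_ge0 ?sin_lipschitz //.
  exact: g_le.
move=> /sin_floor_neq sxy; apply: le_trans (ler_normB _ _) _; rewrite !normrZ.
apply: le_trans (ler_wpM2r _ sxy); last first.
  by rewrite mulr_ge0 ?mdist_ge0 ?(ltW b0).
rewrite mulrDl lerD // ler_wpM2l // g_le //.
exact: le_trans yx _.
Qed.

End Patch.

(** The squared norm of the pair is a convex combination of the squared norms of [u] and [v]. *)
Let weighted_norm (u v : H) s c lo hi : s ^+ 2 + c ^+ 2 = 1 -> 0 <= lo ->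
  lo <= `|u| <= hi -> lo <= `|v| <= hi ->
  lo <= `|((s *: u, c *: v) : hsum H H)| <= hi.
Proof.
move=> sc lo0 /andP[ulo uhi] /andP[vlo vhi].
have hi0 : 0 <= hi by rewrite (le_trans lo0) // (le_trans ulo).
rewrite hsum_normE /= !normrZ !exprMn !real_normK ?num_real //.
rewrite -[lo]ger0_norm // -[X in _ && (_ <= X)]ger0_norm // -!sqrtr_sqr.
have sq t : lo <= t -> t <= hi -> lo ^+ 2 <= t ^+ 2 <= hi ^+ 2.
  move=> lot thi; have t0 := le_trans lo0 lot.
  by rewrite !ler_pXn2r ?nnegrE ?lot ?thi.
have /andP[u1 u2] := sq _ ulo uhi; have /andP[v1 v2] := sq _ vlo vhi.
have := sqr_ge0 s; have := sqr_ge0 c => c0 s0.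
have sE : s ^+ 2 = 1 - c ^+ 2 by rewrite -sc addrK.
have c1 : 0 <= 1 - c ^+ 2 by rewrite -sE.
by rewrite !ler_wsqrtr //= sE; nra.
Qed.

(** The phase [pi / 2] turns the sine into a cosine, so the squared coefficients sum to 1. *)
Let glued e x : hilbert_sum H H := (patch e 0 x, patch e (pi / 2) x).

Let glued_bilipschitz d : 0 < d ->
  bilipschitz (a - d) (b + d) (glued (d / (2 * b))).
Proof.
(* Each of the two patches costs [e * b * mdist x y]; this [e] makes the total [d * mdist x y]. *)
move=> d0 x y; set e := d / (2 * b).
have e0 : 0 < e by rewrite divr_gt0 ?mulr_gt0.
have ebE : e * b = d / 2 by rewrite /e; field; rewrite gt_eqF.
wlog yx : x y / mdist o y <= mdist o x => [th|].
  by have [|/ltW] := leP (mdist o y) (mdist o x) => /th //;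
    rewrite (metric_sym x) distrC.
pose m : hilbert_sum H H :=
  (sin (e * ln (mdist o x) + 0) *: (patch_map e 0 x x - patch_map e 0 x y),
   sin (e * ln (mdist o x) + pi / 2) *:
     (patch_map e (pi / 2) x x - patch_map e (pi / 2) x y)).
have near_m : `|glued e x - glued e y - m| <= d * mdist x y.
  apply: le_trans (hsum_norm_le _) _.
  rewrite [d]splitr mulrDl -ebE lerD //; exact: patch_near.
have m_bounds : a * mdist x y <= `|m| <= b * mdist x y.
  apply: weighted_norm; [|exact/mulr_ge0/mdist_ge0/ltW|exact: patch_mapP..].
  by rewrite addr0 sinDpihalf addrC cos2Dsin2.
have := ler_normB (glued e x - glued e y) (glued e x - glued e y - m).
have := ler_normD (glued e x - glued e y - m) m.
rewrite subrK opprB [_ + (m - _)]addrC subrK.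
by case/andP: m_bounds; rewrite mulrBl mulrDl; move=> *; apply/andP; split; lra.
Qed.

Lemma glue_normalized d : 0 < d ->
  exists f : X -> hilbert_sum H H, bilipschitz (a - d) (b + d) f.
Proof. by move=> /glued_bilipschitz; exists (glued (d / (2 * b))). Qed.

End Gluing.

(** Translating each embedding so that [o] goes to 0 changes no distance and reduces this to
    [glue_normalized]. *)
Lemma bilipschitz_glue (R : realType) (X : metricType R) (o : X)
    (H : hilbert R) (a b d : R) : 0 < a -> a <= b -> 0 < d ->
  (forall M, exists g : X -> H, forall x y, mdist o x <= M -> mdist o y <= M ->
    a * mdist x y <= `|g x - g y| <= b * mdist x y) ->
  exists f : X -> hilbert_sum H H, bilipschitz (a - d) (b + d) f.
Proof.
move=> a0 ab d0 /choice[g gP].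
apply: (@glue_normalized R X o H a b a0 ab (fun M x => g M x - g M o)) => //.
  by move=> M; rewrite subrr.
by move=> M x y xM yM; rewrite opprB addrA subrK; exact: gP.
Qed.

(** * Euclidean geometry *)

Section EuclideanQuotient.
Variables (R : realType) (W : vectType R) (dot : {dot W for @idfun R}).
Implicit Types (x y u v w : W) (G : finOrthGroup dot) (U V : {vspace W}).

Local Notation dist := (euclid_dist dot).

Lemma dot_sym x y : dot x y = dot y x.
Proof. by rewrite (hermC dot x y) /= expr0 mul1r. Qed.

Let dotBl x y z : dot (x - y) z = dot x z - dot y z.
Proof. by rewrite linearBl. Qed.

Let dotDr x y z : dot z (x + y) = dot z x + dot z y.
Proof. by rewrite linearDr. Qed.

Let dotZl a x y : dot (a *: x) y = a * dot x y.
Proof. by rewrite linearZl_LR. Qed.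

Let dotZr a x y : dot x (a *: y) = a * dot x y.
Proof. by rewrite linearZr_LR. Qed.

Let orthP V x :
  reflect (forall v, v \in V -> dot x v = 0) (x \in orthov dot V).
Proof. exact: mem_orthovP. Qed.

Lemma dot_ge0 x : 0 <= dot x x.
Proof.
have [->|x0] := eqVneq x 0; first by rewrite linear0l.
exact/ltW/neq0_dnorm_gt0.
Qed.

Lemma euclid_dist_sqr x y : dist x y ^+ 2 = dot (x - y) (x - y).
Proof. by rewrite sqr_sqrtr // dot_ge0. Qed.

Lemma euclid_dist_pythagoras x x' y y' : dot (x - y) (x' - y') = 0 ->
  dist (x + x') (y + y') ^+ 2 = dist x y ^+ 2 + dist x' y' ^+ 2.
Proof. by move=> o; rewrite !euclid_dist_sqr opprD addrACA hnormDd. Qed.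

Lemma euclid_dist_addl v x y : dist (v + x) (v + y) = dist x y.
Proof. by rewrite /euclid_dist opprD addrACA subrr add0r. Qed.

Lemma euclid_distZ t x y : 0 <= t -> dist (t *: x) (t *: y) = t * dist x y.
Proof.
move=> t0; rewrite /euclid_dist -scalerBr dotZl dotZr mulrA.
by rewrite sqrtrM ?mulr_ge0 // -expr2 sqrtr_sqr ger0_norm.
Qed.

Lemma euclid_dist_addZl v t x : 0 <= t -> dist (v + t *: x) v = t * dist x 0.
Proof.
by move=> t0; rewrite -{2}[v]addr0 euclid_dist_addl -{1}(scaler0 W t)
  euclid_distZ.
Qed.

Definition line_coef u x : R := dot x u / dot u u.

Lemma line_coef_ortho u x : u != 0 -> dot (x - line_coef u x *: u) u = 0.
Proof.
move=> u0; rewrite dotBl dotZl /line_coef divfK ?subrr //.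
by rewrite gt_eqF // neq0_dnorm_gt0.
Qed.

Lemma orthov1_split V u x : u != 0 -> u \in V -> x \in V ->
  x - line_coef u x *: u \in (V :&: orthov dot <[u]>)%VS.
Proof.
move=> u0 uV xV; rewrite memv_cap rpredB ?rpredZ //=.
by rewrite mem_orthov1; apply/eqP; exact: line_coef_ortho.
Qed.

(** Induction on the dimension by splitting off an orthogonal line: a nonzero [u] in [V] is not
    orthogonal to itself, so the dimension drops. *)
Lemma vspace_orthov1_ind (P : {vspace W} -> Prop) : P 0%VS ->
  (forall V u, u != 0 -> u \in V -> P (V :&: orthov dot <[u]>)%VS -> P V) ->
  forall V, P V.
Proof.
move=> P0 PS V; have [n] := ubnP (\dim V); elim: n V => // n IH V Vn.
have [->//|V0] := eqVneq V 0%VS.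
apply: (PS V (vpick V)); rewrite ?vpick0 ?memv_pick //; apply: IH.
rewrite -ltnS; apply: leq_trans Vn.
rewrite ltnS (ltn_leqif (dimv_leqif_sup (capvSl _ _))).
apply/negP => /subvP/(_ _ (memv_pick V)).
rewrite memv_cap mem_orthov1 => /andP[_]; apply/negP.
by rewrite gt_eqF // neq0_dnorm_gt0 // vpick0.
Qed.

Lemma orthov_decomp V x : exists2 p, p \in V & x - p \in orthov dot V.
Proof.
elim/vspace_orthov1_ind: V => [|V u u0 uV [p]].
  exists 0; rewrite ?mem0v //; apply/orthP => v.
  by rewrite memv0 => /eqP->; rewrite linear0r.
rewrite memv_cap mem_orthov1 => /andP[pV /eqP pu] /orthP xp.
exists (p + line_coef u x *: u); first by rewrite rpredD ?rpredZ.
apply/orthP => v vV; rewrite -[v](subrK (line_coef u v *: u)).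
have v'V := orthov1_split u0 uV vV.
rewrite dotDr dotZr !opprD !addrA.
have -> : dot (x - p - line_coef u x *: u) u = 0.
  by rewrite addrAC dotBl line_coef_ortho // [dot p u]pu subr0.
rewrite mulr0 addr0 dotBl [dot (x - p) _]xp // dotZl.
by rewrite dot_sym line_coef_ortho // mulr0 subr0.
Qed.

(** [W] with [dot] is not itself a [hilbert]; a target is assembled from copies of the real line,
    one orthogonal coordinate at a time. *)
Lemma subspace_hilbert_embedding V : exists (E : hilbert R) (j : W -> E),
  {in V &, forall x y, `|j x - j y| = dist x y}.
Proof.
elim/vspace_orthov1_ind: V => [|V u u0 uV [E [j jP]]].
  exists (hilbert_real R), (fun=> 0) => x y; rewrite !memv0 => /eqP-> /eqP->.
  by rewrite subrr normr0 euclid_distxx.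
(* As [u] is not normalized, the factor [Num.sqrt (dot u u)] turns its coefficient into a length. *)
exists (hilbert_sum E (hilbert_real R)), (fun x =>
  (j (x - line_coef u x *: u), line_coef u x * Num.sqrt (dot u u))).
move=> x y xV yV.
rewrite hsum_normE /= jP ?orthov1_split //.
rewrite -[RHS]ger0_norm ?euclid_dist_ge0 // -[RHS]sqrtr_sqr; congr Num.sqrt.
have := @euclid_dist_pythagoras (x - line_coef u x *: u) (line_coef u x *: u)
  (y - line_coef u y *: u) (line_coef u y *: u).
rewrite !subrK => ->; last first.
  by rewrite -scalerBl dotZr dotBl !line_coef_ortho // subrr mulr0.
congr (_ + _); rewrite -[in LHS]mulrBl [in RHS]euclid_dist_sqr.
rewrite -[in RHS]scalerBl.
rewrite real_normK ?num_real // exprMn sqr_sqrtr ?dot_ge0 //.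
by rewrite dotZr dotZl mulrA -expr2.
Qed.

End EuclideanQuotient.

(** * Orbit spaces *)

Lemma finite_set_argmin (R : realType) (T : choiceType) (F : T -> R)
    (D : set T) : finite_set D -> D !=set0 ->
  exists2 m, D m & forall t, D t -> F m <= F t.
Proof.
move=> /finite_seqP[s ->] [y]; case: s => [|x s] //= _.
elim: s x => [|z s IH] x.
  by exists x => [|t] /=; rewrite mem_seq1 // => /eqP->.
have [m /= ms mle] := IH z; have [xm|/ltW mx] := leP (F x) (F m).
  exists x => [|t] /=; first exact: mem_head.
  by rewrite in_cons => /predU1P[->//|/mle]; exact: le_trans.
exists m => [|t] /=; first by rewrite in_cons ms orbT.
by rewrite in_cons => /predU1P[->//|/mle].
Qed.

Section OrbitSpace.
Variables (R : realType) (W : vectType R) (dot : {dot W for @idfun R}).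
Implicit Types (x y u v w : W) (G : finOrthGroup dot) (U V : {vspace W}).

Local Notation dist := (euclid_dist dot).

Definition to_orbit G U x (xU : x \in U) : orbit_space G U :=
  exist _ (orbit_of G x) (ex_intro2 _ _ x xU erefl).

Lemma orbit_rep G U (A : orbit_space G U) : exists2 x, x \in U & sval A x.
Proof.
by case: A => _ /= [x xU ->]; exists x => //; exact: orbit_of_refl.
Qed.

Lemma orbit_svalE G U (A : orbit_space G U) x :
  sval A x -> sval A = orbit_of G x.
Proof. by case: A => _ /= [y _ ->]; exact: orbit_of_eq. Qed.

Section Distance.
Variables (G : finOrthGroup dot) (U : {vspace W}) (A B : orbit_space G U).
Variables (x y : W).
Hypotheses (Ax : sval A x) (By : sval B y).

Lemma orbit_dist_le g : fog_set G g -> mdist A B <= dist x (g y).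
Proof.
move=> Gg; apply: ge_inf.
  by exists 0 => _ [? _ [? _ <-]]; exact: euclid_dist_ge0.
by exists x => //; exists (g y) => //; rewrite (orbit_svalE By); exists g.
Qed.

(** Since [dist (g x) (h y) = dist x (g^-1 (h y))], one representative can be held fixed, and the
    infimum becomes a minimum over a finite group. *)
Lemma orbit_dist_attained :
  exists2 g, fog_set G g & mdist A B = dist x (g y).
Proof.
have dE : mdist A B = inf [set dist x (g y) | g in fog_set G].
  rewrite [LHS]/(orbit_dist A B); congr inf; apply/seteqP; split.
    move=> _ [p + [q + <-]]; rewrite (orbit_svalE Ax) (orbit_svalE By).
    move=> [g Gg <-] [h Gh <-]; exists (g^-1 \o h)%VF; first exact/fogM/Gh/fogV.
    rewrite comp_lfunE -(euclid_dist_isometry (g x) (h y) (fogV Gg)).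
    by rewrite (fogVK Gg).
  move=> _ [g Gg <-]; exists x => //; exists (g y) => //.
  by rewrite (orbit_svalE By); exists g.
have [|g Gg gmin] :=
    finite_set_argmin (fun g : 'End(W) => dist x (g y)) (fog_finite G).
  by exists \1%VF; exact: fog1.
exists g => //; rewrite dE; apply/eqP; rewrite eq_le; apply/andP; split.
  apply: ge_inf; last by exists g.
  by exists 0 => _ [? _ <-]; exact: euclid_dist_ge0.
by apply: lb_le_inf => [|_ [h Gh <-]]; [exists (dist x (g y)), g|exact: gmin].
Qed.

End Distance.

(** The orbit of 0 is a singleton. This supplies the two distinct points that the lemmas on [c2] ask
    for. *)
Lemma to_orbit_neq0 G U x (xU : x \in U) :
  x != 0 -> to_orbit G xU <> to_orbit G (mem0v U).
Proof.
move=> /eqP x0 /(congr1 sval) /= E; apply: x0.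
have : orbit_of G 0 x by rewrite -E; exact: orbit_of_refl.
by case=> g _ <-; rewrite linear0.
Qed.

Lemma orbit_space0 G (A B : orbit_space G 0%VS) : A = B.
Proof.
case: A B => [A /[dup] [[x x0 EA]] hA] [B /[dup] [[y y0 EB]] hB].
apply: eq_sig_hprop => [? ? ?|/=]; first exact: Prop_irrelevance.
by move: x0 y0 EA EB; rewrite !memv0 => /eqP-> /eqP-> -> ->.
Qed.

End OrbitSpace.

Arguments to_orbit_neq0 {R W dot} G {U x} xU.

(** * Comparison of the three quotients *)

Lemma exists_small_scale (R : realFieldType) (r N : R) :
  0 < r -> 0 <= N -> exists2 t, 0 < t & t * N <= r.
Proof.
move=> r0 N0; have N1 : 0 < N + 1 by rewrite ltr_wpDl.
exists (r / (N + 1)); first exact: divr_gt0.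
by rewrite mulrAC ler_pdivrMr // ler_pM2l // lerDl.
Qed.

Section Corollary.
Variables (R : realType) (W : vectType R) (dot : {dot W for @idfun R}).
Variables (G : finOrthGroup dot) (V : {vspace W}).
Implicit Types (x y u v w : W).

Local Notation dist := (euclid_dist dot).

Lemma bilipschitz_orthov_full (H : hilbert R) a b
    (f : orbit_space (pstab G V) (orthov dot V) -> H) :
  0 < a -> a <= b -> bilipschitz a b f ->
  exists (H' : hilbert R) (F : orbit_space (pstab G V) fullv -> H'),
    bilipschitz a b F.
Proof.
move=> a0 ab fab; have b0 := lt_le_trans a0 ab.
have [E [j jP]] := subspace_hilbert_embedding dot V.
(* Any choice of representatives will do: [dE] below holds for whichever ones are picked. *)
have /choice[r rP] (A : orbit_space (pstab G V) fullv) : exists pq : W * W,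
    [/\ pq.1 \in V, pq.2 \in orthov dot V & sval A (pq.1 + pq.2)].
  have [x _ Ax] := orbit_rep A; have [p pV qV] := orthov_decomp dot V x.
  by exists (p, x - p); rewrite /= subrKC.
have rV A : (r A).2 \in orthov dot V by case: (rP A).
pose q A := to_orbit (pstab G V) (rV A).
exists (hilbert_sum E H), (fun A => (a *: j (r A).1, f (q A))) => A B.
have [AV Ao Ar] := rP A; have [BV Bo Br] := rP B.
have qr C : sval (q C) (r C).2 by exact: orbit_of_refl.
have split g : fog_set (pstab G V) g ->
    dist ((r A).1 + (r A).2) (g ((r B).1 + (r B).2)) ^+ 2
      = dist (r A).1 (r B).1 ^+ 2 + dist (r A).2 (g (r B).2) ^+ 2.
  move=> Gg; have [_ gV] := Gg.
  rewrite linearD /= (gV _ BV) euclid_dist_pythagoras // dot_sym.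
  apply: (mem_orthovP (rpredB Ao (pstab_orthov Gg Bo))); exact: rpredB.
(* The element attaining the minimum on one side is a competitor on the other. *)
have dE : mdist A B ^+ 2
    = dist (r A).1 (r B).1 ^+ 2 + mdist (q A) (q B) ^+ 2.
  apply/eqP; rewrite eq_le; apply/andP; split.
    have [g Gg ->] := orbit_dist_attained (qr A) (qr B).
    rewrite -split // ler_pXn2r ?nnegrE ?mdist_ge0 ?euclid_dist_ge0 //.
    exact: orbit_dist_le.
  have [g Gg ->] := orbit_dist_attained Ar Br.
  rewrite split // lerD2l ler_pXn2r ?nnegrE ?mdist_ge0 ?euclid_dist_ge0 //.
  exact: orbit_dist_le.
have /andP[fa fb] := fab (q A) (q B).
rewrite hsum_normE /= -scalerBr normrZ jP // (gtr0_norm a0).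
have m0 := mdist_ge0 A B; have mq0 := mdist_ge0 (q A) (q B).
rewrite -[X in X <= _]ger0_norm ?mulr_ge0 ?(ltW a0) //.
rewrite -[X in _ && (_ <= X)]ger0_norm ?mulr_ge0 ?(ltW b0) //.
rewrite -[`|a * _|]sqrtr_sqr -[`|b * _|]sqrtr_sqr !exprMn dE.
have fa2 : (a * mdist (q A) (q B)) ^+ 2 <= `|f (q A) - f (q B)| ^+ 2.
  by rewrite ler_pXn2r ?nnegrE ?mulr_ge0 ?(ltW a0).
have fb2 : `|f (q A) - f (q B)| ^+ 2 <= (b * mdist (q A) (q B)) ^+ 2.
  by rewrite ler_pXn2r ?nnegrE ?mulr_ge0 ?(ltW b0).
have ab2 : a ^+ 2 <= b ^+ 2.
  by rewrite ler_pXn2r ?nnegrE ?(ltW a0) ?(ltW b0).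
have ab2d := ler_wpM2r (sqr_ge0 (dist (r A).1 (r B).1)) ab2.
move: fa2 fb2; rewrite !exprMn => fa2 fb2.
by apply/andP; split; apply: ler_wsqrtr; lra.
Qed.

(** A point of the smaller quotient is the same set of vectors as a point of the larger one, and
    distances depend only on these sets, so the inclusion is isometric by conversion. *)
Lemma bilipschitz_full_orthov (H : hilbert R) a b
    (f : orbit_space (pstab G V) fullv -> H) :
  bilipschitz a b f ->
  exists F : orbit_space (pstab G V) (orthov dot V) -> H, bilipschitz a b F.
Proof.
move=> fab.
have fullP (A : orbit_space (pstab G V) (orthov dot V)) :
    exists2 x, x \in fullv & sval A = orbit_of (pstab G V) x.
  by case: A => _ /= [x _ ->]; exists x => //; rewrite memvf.
exists (fun A => f (exist _ (sval A) (fullP A))) => A B.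
exact: fab (exist _ (sval A) (fullP A)) (exist _ (sval B) (fullP B)).
Qed.

(** Induction on an enumeration of the group: when the next [g] fixes the current [v], a small
    multiple of a vector [w] of [V] moved by [g] is added to [v]. *)
Lemma pstab_separating_vector : exists v r, [/\ v \in V, 0 < r &
  forall g, fog_set G g -> ~ fog_set (pstab G V) g -> r <= dist (g v) v].
Proof.
have /finite_seqP[s sE] := fog_finite G.
suff [v [r [vV r0 vr]]] : exists v r, [/\ v \in V, 0 < r & forall g, g \in s ->
    fog_set G g -> ~ fog_set (pstab G V) g -> r <= dist (g v) v].
  exists v, r; split=> // g Gg; apply: vr => //.
  by move: Gg; rewrite sE.
elim: s {sE} => [|g s [v [r [vV r0 vr]]]]; first by exists 0, 1; rewrite mem0v.
have [gS|gS] := pselect (fog_set G g /\ ~ fog_set (pstab G V) g); last first.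
  exists v, r; split=> // h; rewrite in_cons => /predU1P[->|]; last exact: vr.
  by move=> Gg Sg; case: gS.
have [gv|gv] := eqVneq (g v) v; last first.
  exists v, (Num.min r (dist (g v) v)); split=> // [|h].
    rewrite lt_min r0 lt_neqAle euclid_dist_ge0 andbT eq_sym.
    by apply: contra_neq gv; exact: euclid_dist_eq0.
  rewrite in_cons ge_min => /predU1P[->|hs Gh Sh]; first by rewrite lexx orbT.
  by rewrite vr.
have [Gg Sg] := gS.
have [w wV gw] : exists2 w, w \in V & g w <> w.
  apply: contra_notP Sg => gV; split=> // w wV.
  by apply: contra_notP gV => gw; exists w.
(* With [c * dist w 0 <= r / 4], an element moving [v] by at least [r] still moves [v + c *: w] by
   at least [r - 2 * (r / 4) = r / 2]. *)
have r4 : 0 < r / 4 by rewrite divr_gt0.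
have [c c0 cN] := exists_small_scale r4 (euclid_dist_ge0 dot w 0).
have gw0 : 0 < dist (g w) w.
  rewrite lt_neqAle euclid_dist_ge0 andbT eq_sym.
  by apply/eqP => /euclid_dist_eq0.
exists (v + c *: w), (Num.min (r / 2) (c * dist (g w) w)); split=> [||h].
- by rewrite rpredD ?rpredZ.
- by rewrite lt_min divr_gt0 // mulr_gt0.
rewrite in_cons ge_min => /predU1P[->|hs] Gh Sh.
  rewrite linearD linearZ /= gv euclid_dist_addl euclid_distZ ?(ltW c0) //.
  by rewrite lexx orbT.
apply/orP; left.
have := vr h hs Gh Sh.
have := euclid_dist_triangle dot (h (v + c *: w)) (h v) v.
have := euclid_dist_triangle dot (v + c *: w) (h (v + c *: w)) v.
rewrite (euclid_distC dot (h v) (h _)) (euclid_dist_isometry _ _ Gh).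
rewrite euclid_dist_addZl ?(ltW c0) //.
by lra.
Qed.

Lemma bilipschitz_blowup (H : hilbert R) a b d (f : orbit_space G fullv -> H) :
  0 < a -> a <= b -> 0 < d -> bilipschitz a b f ->
  exists (H' : hilbert R) (F : orbit_space (pstab G V) fullv -> H'),
    bilipschitz (a - d) (b + d) F.
Proof.
move=> a0 ab d0 fab; exists (hilbert_sum H H).
pose o := to_orbit (pstab G V) (mem0v fullv).
apply: (bilipschitz_glue (o := o)) => // M.
have [v [r [vV r0 vr]]] := pstab_separating_vector.
have r4 : 0 < r / 4 by rewrite divr_gt0.
(* The scale [t] brings the ball of radius [M] within [r / 4] of [v]; the absolute value covers
   negative [M]. *)
have [t t0 tM] := exists_small_scale r4 (normr_ge0 M).
have {}tM : t * M <= r / 4.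
  exact: le_trans (ler_wpM2l (ltW t0) (ler_norm M)) tM.
have /choice[x xP] (A : orbit_space (pstab G V) fullv) : exists x, sval A x.
  by have [x _ Ax] := orbit_rep A; exists x.
pose e A := to_orbit G (memvf (v + t *: x A)).
have eP A : sval (e A) (v + t *: x A) by exact: orbit_of_refl.
(* All elements fix 0, so the distance from [o] to [A] is the norm of any representative. *)
have x_le A : mdist o A <= M -> t * dist (x A) 0 <= r / 4.
  move=> AM; apply: le_trans tM; rewrite ler_pM2l //; apply: le_trans AM.
  have o0 : sval o 0 by exact: orbit_of_refl.
  have [g Gg ->] := orbit_dist_attained o0 (xP A).
  rewrite -[X in dist X (g _)](linear0 g) (euclid_dist_isometry _ _ Gg).
  by rewrite euclid_distC lexx.
have eE A B : mdist o A <= M -> mdist o B <= M ->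
    mdist (e A) (e B) = t * mdist A B.
  move=> /x_le AM /x_le BM; apply/eqP; rewrite eq_le; apply/andP; split.
    have [g Sg ->] := orbit_dist_attained (xP A) (xP B); have [Gg gV] := Sg.
    apply: le_trans (orbit_dist_le (eP A) (eP B) Gg) _.
    by rewrite linearD linearZ /= gV // euclid_dist_addl euclid_distZ ?(ltW t0).
  have [g Gg ->] := orbit_dist_attained (eP A) (eP B).
  have [Sg|Sg] := pselect (fog_set (pstab G V) g).
    have [_ gV] := Sg.
    rewrite linearD linearZ /= gV // euclid_dist_addl euclid_distZ ?(ltW t0) //.
    by rewrite ler_pM2l //; exact: orbit_dist_le.
  (* An element outside the stabilizer moves [v] by at least [r], so it leaves the two points at
     least [r - 2 * (r / 4) = r / 2] apart, while [t * mdist A B] is at most [t * (dist (x A) 0 +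
     dist (x B) 0) <= r / 2]. *)
  have := vr g Gg Sg.
  have := orbit_dist_le (xP A) (xP B) (fog1 (pstab G V)).
  rewrite id_lfunE -(ler_pM2l t0) => h1.
  have := ler_wpM2l (ltW t0) (euclid_dist_triangle dot 0 (x A) (x B)).
  have := euclid_dist_triangle dot (v + t *: x A) (g v) v.
  have := euclid_dist_triangle dot (g (v + t *: x B)) (g v) (v + t *: x A).
  rewrite (euclid_dist_isometry _ _ Gg) (euclid_distC dot v).
  rewrite !euclid_dist_addZl ?(ltW t0) //.
  rewrite (euclid_distC dot (g v) (v + _)) (euclid_distC dot (g _) (v + _)).
  rewrite (euclid_distC dot 0) mulrDr.
  by lra.
(* Dividing by [t] restores the constants [a] and [b], so they and the target [H] are the same for
   every [M]. *)
exists (fun A => t^-1 *: f (e A)) => A B AM BM.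
rewrite -scalerBr normrZ gtr0_norm ?invr_gt0 //.
have := fab (e A) (e B); rewrite eE // => /andP[f1 f2].
rewrite -ler_pdivrMl ?invr_gt0 // invrK ler_pdivrMl // mulrCA f1 /=.
by rewrite mulrCA f2.
Qed.

End Corollary.

Theorem corollary14 (R : realType) (W : vectType R)
    (dot : {dot W for @idfun R}%R) (G : finOrthGroup dot) (V : {vspace W}) :
  c2 (orbit_space (pstab G V) (orthov dot V))
    = c2 (orbit_space (pstab G V) fullv)
  /\ (c2 (orbit_space (pstab G V) fullv) <= c2 (orbit_space G fullv))%E.
Proof.
have c2_trivial (X : metricType R) : (forall x y : X, x = y) -> c2 X = 1%E.
  by move=> X1; rewrite /c2 asboolT.
have perturb (X : metricType R) (H : normedModType R) a b d (f : X -> H) :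
    0 < d -> bilipschitz a b f -> bilipschitz (a - d) (b + d) f.
  move=> d0 fab x y; have := mdist_ge0 x y; have /andP[] := fab x y; nra.
(* For zero [W] every quotient is a point, where [c2] is 1 by convention. *)
have [W0|W0] := eqVneq (fullv : {vspace W}) 0%VS.
  have orthov0 : orthov dot V = 0%VS by apply/eqP; rewrite -subv0 -W0 subvf.
  rewrite W0 orthov0 [in leLHS]c2_trivial ?c2_ge1 //; exact: orbit_space0.
pose w := vpick (fullv : {vspace W}).
have w0 : w != 0 by rewrite vpick0.
have dG := to_orbit_neq0 G (memvf w) w0.
have dS := to_orbit_neq0 (pstab G V) (memvf w) w0.
split; last first.
  apply: (c2_le_perturb dS dG) => H f a b d a0 ab d0 fab.
  exact: bilipschitz_blowup fab.
have [V0|V0] := eqVneq (orthov dot V) 0%VS.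
  have triv : forall A B : orbit_space (pstab G V) (orthov dot V), A = B.
    by rewrite V0; exact: orbit_space0.
  rewrite c2_trivial //; apply/eqP; rewrite eq_le c2_ge1 /=.
  (* On a one-point space the constant map has any constants; with 1 and 1 it extends to an
     isometric embedding of the full quotient. *)
  have iso0 : bilipschitz 1 1 ((fun=> 0) :
      orbit_space (pstab G V) (orthov dot V) -> hilbert_real R).
    by move=> A B; rewrite (triv A B) subrr normr0 mdistxx !mulr0 lexx.
  have [H [F FP]] := bilipschitz_orthov_full ltr01 (lexx 1) iso0.
  by have := c2_le dS ltr01 FP; rewrite divr1.
have u0 : vpick (orthov dot V) != 0 by rewrite vpick0.
have dO := to_orbit_neq0 (pstab G V) (memv_pick (orthov dot V)) u0.
apply/eqP; rewrite eq_le; apply/andP; split.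
  apply: (c2_le_perturb dO dS) => H f a b d a0 ab d0.
  move=> /bilipschitz_full_orthov[F FP].
  by exists H, F; exact: perturb.
apply: (c2_le_perturb dS dO) => H f a b d a0 ab d0.
move=> /(bilipschitz_orthov_full a0 ab)[H' [F FP]].
by exists H', F; exact: perturb.
Qed.
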